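(* Let $F\in\mathbb{V}'$, $G\in\mathbb{Q}'$, $\rho\in\mathbb{R}$, and consider the iterated penalty method with $\lambda=\rho$, with iterates $(u^n_{X,\rho,\rho},p^n_{X,\rho,\rho})$, for the discrete saddle point problem with solution $(u_X,p_X)$ (all defined in the context). (i) General case (no structural assumption on $a$ beyond the setting in the context; in particular, neither symmetry and nonnegativity of $a$ on $\mathbb{V}$ together with coercivity on $\mathbb{Z}$, nor coercivity of $a$ on $\mathbb{V}$, is assumed): let $\Upsilon_X:=1+\frac{M_a}{\alpha_X}$, $\epsilon_0:=\frac1{M_a}\left(\frac{\beta_X}{\Upsilon_X}\right)^2$ and $$\rho_0:=\frac1{\epsilon_0}\left(1+\frac1{\Upsilon_X}\right)=\frac{(M_a+\alpha_X)(M_a+2\alpha_X)M_a}{\alpha_X^2\beta_X^2}.$$ If $\rho>\rho_0$, then the iterated penalty method with $\lambda=\rho$ converges geometrically with a rate given by $$\frac1{\Upsilon_X(\rho\epsilon_0-1)}=\frac{\rho_0}{\Upsilon_X(\rho-\rho_0)+\rho}=\frac{M_a\alpha_X(\alpha_X+M_a)}{\rho\alpha_X^2\beta_X^2-M_a(\alpha_X+M_a)^2}.$$ (ii) Suppose that at least one of the following two conditions holds: - (symmetric, nonnegative, coercive on the kernel) $a$ is symmetric and there is $\tilde\alpha_X>0$ with $a(u,u)\ge0$ for all $u\in\mathbb{V}$ and $a(z,z)\ge\tilde\alpha_X\|z\|_V^2$ for all $z\in\mathbb{Z}$; - (coercive on $\mathbb{V}$) there is $\tilde\alpha_X>0$ with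 $a(u,u)\ge\tilde\alpha_X\|u\|_V^2$ for all $u\in\mathbb{V}$. Then for all $\rho>0$ the iterated penalty method with $\lambda=\rho$ converges geometrically with a rate given by $$\frac{M_a}{M_a+\rho\beta_X^2}\ \text{ if } a \text{ is symmetric, nonnegative on } \mathbb{V} \text{ and coercive on } \mathbb{Z} \text{ (first condition)},$$ or $$\frac{M_a\Upsilon_X}{M_a\Upsilon_X+\rho\beta_X^2}\ \text{ if } a \text{ is coercive on } \mathbb{V} \text{ (second condition)},$$ where, when $a$ is coercive on $\mathbb{V}$ with constant $\tilde\alpha_X$, $\Upsilon_X=M_a/\tilde\alpha_X$ if $a$ is not symmetric and $\Upsilon_X=\sqrt{M_a/\tilde\alpha_X}$ if $a$ is symmetric.
   Context: Setting. $V,Q$ are real Hilbert spaces with inner products $(\cdot,\cdot)_V,(\cdot,\cdot)_Q$, norms $\|\cdot\|_V,\|\cdot\|_Q$ and duals denoted by a prime. $a:V\times V\to\mathbb{R}$ is a continuous (not necessarily symmetric) bilinear form and $\mathcal{D}:V\to Q$ is a surjective bounded linear operator. With $Z=\ker\mathcal{D}$, there is $\alpha>0$ with $\alpha\le\inf_{u\in Z}\sup_{v\in Z}\frac{a(u,v)}{\|u\|_V\|v\|_V}$ and $\alpha\le\inf_{v\in Z}\sup_{u\in Z}\frac{a(u,v)}{\|u\|_V\|v\|_V}$. Infima and suprema of quotients are over nonzero vectors. $\mathbb{V}\subset V$, $\mathbb{Q}\subset Q$ are finite-dimensional subspaces with $\mathcal{D}\mathbb{V}=\mathbb{Q}$.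 Let $\mathbb{Z}=\{v\in\mathbb{V}:(\mathcal{D}v,q)_Q=0\ \forall q\in\mathbb{Q}\}$ and assume $$\alpha_X:=\inf_{u\in\mathbb{Z}}\sup_{v\in\mathbb{Z}}\frac{a(u,v)}{\|u\|_V\|v\|_V}=\inf_{v\in\mathbb{Z}}\sup_{u\in\mathbb{Z}}\frac{a(u,v)}{\|u\|_V\|v\|_V}>0,\qquad \beta_X:=\inf_{q\in\mathbb{Q}}\sup_{v\in\mathbb{V}}\frac{(\mathcal{D}v,q)_Q}{\|v\|_V\|q\|_Q}>0.$$ Let $M_a:=\sup_{u,v\in V}\frac{a(u,v)}{\|u\|_V\|v\|_V}$. $\mathcal{R}_{\mathbb{Q}}:\mathbb{Q}\to\mathbb{Q}'$ is the Riesz map, $(\mathcal{R}_{\mathbb{Q}}p)(q)=(p,q)_Q$. Discrete saddle point problem: find $u_X\in\mathbb{V}$, $p_X\in\mathbb{Q}$ with $a(u_X,v)+(\mathcal{D}v,p_X)_Q=F(v)$ for all $v\in\mathbb{V}$ and $(\mathcal{D}u_X,q)_Q=G(q)$ for all $q\in\mathbb{Q}$ (it is uniquely solvable). Iterated penalty method with parameters $\lambda,\rho$: $p^0_{X,\lambda,\rho}:=0$ and for $n\ge1$, $u^n_{X,\lambda,\rho}\in\mathbb{V}$, $p^n_{X,\lambda,\rho}\in\mathbb{Q}$ are defined by $$a(u^n_{X,\lambda,\rho},v)+\lambda(\mathcal{D}u^n_{X,\lambda,\rho},\mathcal{D}v)_Q=F(v)+\lambda G(\mathcal{D}v)-(\mathcal{D}v,p^{n-1}_{X,\lambda,\rho})_Q\quad\forall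 v\in\mathbb{V},$$ $$p^n_{X,\lambda,\rho}=p^{n-1}_{X,\lambda,\rho}+\rho(\mathcal{D}u^n_{X,\lambda,\rho}-\mathcal{R}_{\mathbb{Q}}^{-1}G).$$ ''Converges geometrically with a rate given by $r$'' means: the iterates are well-defined, $r<1$, and there is a constant $C\ge0$ independent of $n$ such that $\|u_X-u^n_{X,\rho,\rho}\|_V+\|p_X-p^n_{X,\rho,\rho}\|_Q\le C r^n$ for all $n\ge1$. *)

(* Defs.v *)
From HB Require Import structures.
From mathcomp Require Import all_boot all_order all_algebra.
From mathcomp Require Import all_classical all_reals all_analysis.

Set Implicit Arguments.
Unset Strict Implicit.
Unset Printing Implicit Defensive.

Import Order.TTheory GRing.Theory Num.Theory.
Import numFieldNormedType.Exports.

Local Open Scope classical_set_scope.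
Local Open Scope ring_scope.

Definition fin_dim_subspace (R : realType) (W : lmodType R) (S : set W) : Prop :=
  exists (n : nat) (e : 'I_n -> W),
    S = [set w | exists c : 'I_n -> R, w = \sum_(i < n) c i *: e i].

(* Functionals on a subspace S are represented by functions on the whole space;
   only their values on S are constrained (or used). *)
Definition in_dual (R : realType) (W : normedModType R) (S : set W)
    (F : W -> R) : Prop :=
  (forall (c : R) (x y : W), S x -> S y -> F (c *: x + y) = c * F x + F y) /\
  (exists C : R, forall x, S x -> `|F x| <= C * `|x|).

(* Extended-real valued, so that the infimum over an empty set (A contained in
   {0}) is +oo. *)
Definition infsup (R : realType) (U W : normedModType R) (b : U -> W -> R)
    (A : set U) (B : set W) : \bar R :=
  ereal_inf [set ereal_sup [set (b u w / (`|u| * `|w|))%:E | w in B `\ 0]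
            | u in A `\ 0].

(* For a continuous bilinear form the set below is bounded; sup set0 = 0. *)
Definition form_norm (R : realType) (V : normedModType R) (a : V -> V -> R) : R :=
  sup [set a uv.1 uv.2 / (`|uv.1| * `|uv.2|)
      | uv in [set uv : V * V | uv.1 <> 0 /\ uv.2 <> 0]].

Definition ker_op (R : realType) (V Q : lmodType R) (D : V -> Q) : set V :=
  [set v | D v = 0].

Definition discrete_ker (R : realType) (V Q : lmodType R) (ipQ : Q -> Q -> R)
    (D : V -> Q) (VX : set V) (QX : set Q) : set V :=
  [set v | VX v /\ forall q, QX q -> ipQ (D v) q = 0].

(* R_S^-1 G, for G in the dual of a finite-dimensional subspace S. *)
Definition riesz_inv (R : realType) (Q : lmodType R) (ipQ : Q -> Q -> R)
    (S : set Q) (G : Q -> R) : Q :=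
  xget 0 [set p | S p /\ forall q, S q -> ipQ p q = G q].

Definition saddle_point_sol (R : realType) (V Q : lmodType R)
    (ipQ : Q -> Q -> R) (a : V -> V -> R) (D : V -> Q)
    (VX : set V) (QX : set Q) (F : V -> R) (G : Q -> R) (u : V) (p : Q) : Prop :=
  [/\ VX u, QX p,
      forall v, VX v -> a u v + ipQ (D v) p = F v
    & forall q, QX q -> ipQ (D u) q = G q].

(* The value u 0 is not constrained: the iterates u n start at n = 1. *)
Definition penalty_iterates (R : realType) (V Q : lmodType R)
    (ipQ : Q -> Q -> R) (a : V -> V -> R) (D : V -> Q)
    (VX : set V) (QX : set Q) (F : V -> R) (G : Q -> R) (lambda rho : R)
    (u : nat -> V) (p : nat -> Q) : Prop :=
  p 0%N = 0 /\
  forall n, (0 < n)%N ->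
    [/\ VX (u n), QX (p n),
        forall v, VX v ->
          a (u n) v + lambda * ipQ (D (u n)) (D v)
          = F v + lambda * G (D v) - ipQ (D v) (p n.-1)
      & p n = p n.-1 + rho *: (D (u n) - riesz_inv ipQ QX G)].

(* [iter u p] says that (u, p) is a sequence of iterates; well-definedness is
   existence and uniqueness of such a sequence. *)
Definition converges_geometrically (R : realType) (V Q : normedModType R)
    (iter : (nat -> V) -> (nat -> Q) -> Prop) (uX : V) (pX : Q) (r : R) : Prop :=
  [/\ exists u p, iter u p,
      forall u p u' p', iter u p -> iter u' p' ->
        forall n, (0 < n)%N -> u n = u' n /\ p n = p' n,
      r < 1
    & forall u p, iter u p ->
        exists2 C : R, 0 <= C &
          forall n, (0 < n)%N -> `|uX - u n| + `|pX - p n| <= C * r ^+ n].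

(* alphaX = +oo when the discrete kernel is {0}, and betaX = +oo when the
   discrete image space is {0}; then x / +oo = 0. *)
Section Constants.
Local Open Scope ereal_scope.
Variables (R : realType) (Ma : R) (alphaX betaX : \bar R).

Definition Upsilon : \bar R := 1 + Ma%:E / alphaX.
Definition eps0 : \bar R := Ma%:E^-1 * (betaX / Upsilon) ^+ 2.
Definition rho0 : \bar R := eps0^-1 * (1 + Upsilon^-1).

End Constants.

Definition Upsilon_coercive (R : realType) (V : Type) (a : V -> V -> R)
    (Ma alphat : R) : R :=
  if `[< forall u v, a u v = a v u >] then Num.sqrt (Ma / alphat)
  else Ma / alphat.

(* Main.v *)
(* With lambda = rho, the errors u of the velocity and p of the multiplier satisfy
   a(u, v) + (D v, p) = 0 on VX and p = q + rho D u, where q is the previous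
   multiplier error, so it suffices to bound |p| by r |q|.
   In general, the inf-sup conditions give |p| <= K |D u| with
   K = M_a Upsilon / beta^2, whence rho |p| <= K (|p| + |q|).
   In the coercive cases |p|^2 <= nu a(u, u) for some nu, and
   (q, p) = |p|^2 + rho a(u, u) gives (1 + rho / nu) |p| <= |q|.
   The same contraction for the transpose of a makes the penalty problem
   nondegenerate.  The inverses 1 / alpha and 1 / beta (0 when the inf-sup
   constant is +oo) are used as real constants ai and bi. *)
Require Import Defs.
From HB Require Import structures.
From mathcomp Require Import all_boot all_order all_algebra.
From mathcomp Require Import all_classical all_reals all_analysis.
From mathcomp Require Import ring lra.

Import Order.TTheory GRing.Theory Num.Theory.
Import numFieldNormedType.Exports.

Local Open Scope classical_set_scope.
Local Open Scope ring_scope.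

(** * Bilinear forms and the Cauchy-Schwarz inequality *)

Section BilinearForms.
Context {R : realType}.

Definition bilinear_form {U W : lmodType R} (b : U -> W -> R) : Prop :=
  (forall w c x y, b (c *: x + y) w = c * b x w + b y w) /\
  (forall u c x y, b u (c *: x + y) = c * b u x + b u y).

Lemma bilinear_form_flip {U W : lmodType R} {b : U -> W -> R} :
  bilinear_form b -> bilinear_form (fun w u => b u w).
Proof. by case. Qed.

Section Left.
Context {U W : lmodType R} {b : U -> W -> R} (bb : bilinear_form b).

Lemma bformDl x y w : b (x + y) w = b x w + b y w.
Proof. by have := bb.1 w 1 x y; rewrite scale1r mul1r. Qed.

Lemma bform0l w : b 0 w = 0.
Proof. by apply: (addrI (b 0 w)); rewrite -bformDl !addr0. Qed.

Lemma bformZl c x w : b (c *: x) w = c * b x w.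
Proof. by have := bb.1 w c x 0; rewrite addr0 bform0l addr0. Qed.

Lemma bformNl x w : b (- x) w = - b x w.
Proof. by rewrite -scaleN1r bformZl mulN1r. Qed.

Lemma bformBl x y w : b (x - y) w = b x w - b y w.
Proof. by rewrite bformDl bformNl. Qed.

Lemma bform_suml n (c : 'I_n -> R) (e : 'I_n -> U) w :
  b (\sum_(i < n) c i *: e i) w = \sum_(i < n) c i * b (e i) w.
Proof.
rewrite (big_morph (b ^~ w) (fun x y => bformDl x y w) (bform0l w)).
by apply: eq_bigr => i _; rewrite bformZl.
Qed.

End Left.

Section Right.
Context {U W : lmodType R} {b : U -> W -> R} (bb : bilinear_form b).
Let bT := bilinear_form_flip bb.

Lemma bformDr u x y : b u (x + y) = b u x + b u y.
Proof. exact: (bformDl bT). Qed.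

Lemma bform0r u : b u 0 = 0.
Proof. exact: (bform0l bT). Qed.

Lemma bformZr c u x : b u (c *: x) = c * b u x.
Proof. exact: (bformZl bT). Qed.

Lemma bformNr u x : b u (- x) = - b u x.
Proof. exact: (bformNl bT). Qed.

Lemma bformBr u x y : b u (x - y) = b u x - b u y.
Proof. exact: (bformBl bT). Qed.

Lemma bform_sumr n (c : 'I_n -> R) (e : 'I_n -> W) u :
  b u (\sum_(i < n) c i *: e i) = \sum_(i < n) c i * b u (e i).
Proof. exact: (bform_suml bT). Qed.

End Right.

(** The quadratic [t |-> b (x + t y) (x + t y)] is nonnegative. As [b] is only semidefinite,
    [b y y = 0] can occur; the quadratic is then affine in [t], so its slope must vanish. Otherwise
    its minimum over [t] gives the inequality. *)
Lemma form_cauchy_schwarz {W : lmodType R} {b : W -> W -> R}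
    (bb : bilinear_form b) (bC : forall x y, b x y = b y x) (S : set W) :
  (forall c x y, S x -> S y -> S (c *: x + y)) ->
  (forall x, S x -> 0 <= b x x) ->
  forall x y, S x -> S y -> b x y ^+ 2 <= b x x * b y y.
Proof.
move=> Slin b0 x y Sx Sy.
have quad t : 0 <= t ^+ 2 * b y y + 2 * t * b x y + b x x.
  have := b0 _ (Slin t _ _ Sy Sx).
  rewrite bb.1 !bb.2 (bC y x); congr (0 <= _); ring.
have [byy|] := eqVneq (b y y) 0.
  have [->|bxy] := eqVneq (b x y) 0; first by rewrite byy mulr0 expr0n.
  have := quad (- (b x x + 1) / (2 * b x y)).
  have -> : (- (b x x + 1) / (2 * b x y)) ^+ 2 * b y y +
      2 * (- (b x x + 1) / (2 * b x y)) * b x y + b x x = -1.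
    by rewrite byy; field.
  by rewrite lerNr oppr0 ler10.
move=> byy; have byy0 : 0 < b y y by rewrite lt_neqAle eq_sym byy b0.
have := quad (- b x y / b y y).
have -> : (- b x y / b y y) ^+ 2 * b y y + 2 * (- b x y / b y y) * b x y + b x x
    = (b x x * b y y - b x y ^+ 2) / b y y by field.
by rewrite pmulr_lge0 ?invr_gt0// subr_ge0.
Qed.

End BilinearForms.

(** * Finite-dimensional subspaces and solvability of linear systems *)

Section FiniteDimension.
Context {R : realType}.

Lemma fin_dim_lin {W : lmodType R} {S : set W} : fin_dim_subspace S ->
  forall c x y, S x -> S y -> S (c *: x + y).
Proof.
move=> [n [e ->]] c _ _ [f ->] [g ->] /=.
exists (fun i => c * f i + g i); rewrite scaler_sumr -big_split /=.
by apply: eq_bigr => i _; rewrite scalerDl scalerA.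
Qed.

Lemma fin_dim0 {W : lmodType R} {S : set W} : fin_dim_subspace S -> S 0.
Proof.
move=> [n [e ->]]; exists (fun=> 0).
by rewrite big1// => i _; rewrite scale0r.
Qed.

Lemma fin_dimB {W : lmodType R} {S : set W} : fin_dim_subspace S ->
  forall x y, S x -> S y -> S (x - y).
Proof.
move=> Sf x y Sx Sy; rewrite addrC -scaleN1r; exact: (fin_dim_lin Sf).
Qed.

(** Allows a saddle point system in a pair (velocity, multiplier) to be solved as one linear
    system. *)
Lemma fin_dimX {V W : lmodType R} {S : set V} {T : set W} :
  fin_dim_subspace S -> fin_dim_subspace T -> fin_dim_subspace (S `*` T).
Proof.
move=> [m [e ->]] [n [f ->]]; exists (m + n)%N.
exists (fun i : 'I_(m + n) => match fintype.split i with inl j => (e j, 0) | inr k => (0, f k) end).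
have splitl (i : 'I_m) : fintype.split (lshift n i) = inl i.
  exact: (unsplitK (inl i)).
have splitr (i : 'I_n) : fintype.split (rshift m i) = inr i.
  exact: (unsplitK (inr i)).
have sumE (c : 'I_(m + n) -> R) : \sum_(i < m + n) c i *: (match fintype.split i with
      inl j => (e j, 0) | inr k => (0, f k) end : (V * W)%type)
    = (\sum_(i < m) c (lshift n i) *: e i, \sum_(i < n) c (rshift m i) *: f i).
  rewrite big_split_ord /=.
  under eq_bigr do rewrite splitl.
  under [X in _ + X]eq_bigr do rewrite splitr.
  rewrite [LHS]surjective_pairing; congr pair.
    rewrite /= !(big_morph fst (id1 := 0) (op1 := +%R))//=.
    by rewrite [X in _ + X]big1 ?addr0// => i _; rewrite /= scaler0.
  rewrite /= !(big_morph snd (id1 := 0) (op1 := +%R))//=.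
  by rewrite big1 ?add0r// => i _; rewrite /= scaler0.
apply/seteqP; split => [[_ _] [[c /= ->] [d /= ->]]|_ [c ->]].
  exists (fun i : 'I_(m + n) => match fintype.split i with inl j => c j | inr k => d k end).
  rewrite sumE; congr pair; apply: eq_bigr => i _.
    by rewrite splitl.
  by rewrite splitr.
rewrite sumE; split; first by exists (c \o @lshift m n).
by exists (c \o @rshift m n).
Qed.

(** The spanning family may be linearly dependent, so its Gram matrix need not be invertible. The
    system is still solvable, because [F] vanishes on every [w] that [b] annihilates, such a [w]
    being 0. *)
Lemma fin_dim_solve {W : lmodType R} {S : set W} {b : W -> W -> R} {F : W -> R} :
  fin_dim_subspace S -> bilinear_form b ->
  (forall c x y, F (c *: x + y) = c * F x + F y) ->
  (forall w, S w -> (forall u, S u -> b u w = 0) -> w = 0) ->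
  exists2 u, S u & forall v, S v -> b u v = F v.
Proof.
move=> [n [e ->]] bb Flin nondeg.
have bF : bilinear_form (fun (t : R^o) w => t * F w).
  split => [w c x y|u c x y] /=; rewrite ?Flin; last by ring.
  by rewrite /GRing.scale /= mulrDl mulrA.
have F_sum (c : 'I_n -> R) : F (\sum_(i < n) c i *: e i) = \sum_(i < n) c i * F (e i).
  have := bform_sumr bF n c e 1; rewrite mul1r => ->.
  by apply: eq_bigr => i _; rewrite mul1r.
pose A := \matrix_(i < n, j < n) b (e i) (e j).
pose f := \row_(j < n) F (e j).
have : (f <= A)%MS.
  rewrite submxE; apply/eqP/rowP => k; rewrite !mxE.
  (* A column of the cokernel of the Gram matrix is the coordinate vector of some [w] annihilated by
     [b]; the entry to be killed is [F w]. *)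
  pose w := \sum_(j < n) cokermx A j k *: e j.
  have w0 : w = 0.
    apply: nondeg; first by exists (cokermx A ^~ k).
    move=> _ [c ->]; rewrite (bform_suml bb) big1// => i _.
    rewrite (bform_sumr bb).
    have /matrixP/(_ i k) := mulmx_coker A; rewrite !mxE => AK.
    rewrite (_ : \sum_(j < n) cokermx A j k * b (e i) (e j) = 0) ?mulr0//; apply: etrans AK.
    by apply: eq_bigr => j _; rewrite [A i j]mxE mulrC.
  transitivity (F w).
    by rewrite F_sum; apply: eq_bigr => j _; rewrite [f 0 j]mxE mulrC.
  by rewrite w0; have := bform0r bF 1; rewrite mul1r.
move=> /submxP[c fE]; exists (\sum_(i < n) c 0 i *: e i); first by exists (c 0).
move=> _ [d ->]; rewrite (bform_sumr bb) F_sum; apply: eq_bigr => j _.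
have /rowP/(_ j) := fE; rewrite !mxE => ->; congr (_ * _).
by rewrite (bform_suml bb); apply: eq_bigr => i _; rewrite mxE.
Qed.

End FiniteDimension.

(** * Inf-sup constants and norms of forms *)

Section InfSup.
Context {R : realType} {U W : normedModType R}.

(** An inf-sup constant of at least [1 / k], stated without quotients; [k = 0] makes sense and
    covers the constant +oo. *)
Definition inf_sup_bound (b : U -> W -> R) (A : set U) (B : set W) (k : R) :=
  forall u, A u -> forall c, 0 <= c -> (forall w, B w -> b u w <= c * `|w|) ->
  `|u| <= k * c.

(** For nonzero [u] the supremum over [w] is at most [c / |u|], a finite number, so an infinite
    inf-sup constant leaves only [u = 0]. *)
Lemma infsup_bound (b : U -> W -> R) (A : set U) (B : set W) :
  (0 < infsup b A B)%E -> inf_sup_bound b A B (fine (infsup b A B)^-1).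
Proof.
set x := infsup b A B => x0 u Au c c0 bc.
have [->|u0] := eqVneq u 0.
  by rewrite normr0 mulr_ge0// fine_ge0// inve_ge0 ltW.
have nu0 : 0 < `|u| by rewrite normr_gt0.
have : (x <= (c / `|u|)%:E)%E.
  apply: (@le_trans _ _ (ereal_sup [set (b u w / (`|u| * `|w|))%:E | w in B `\ 0])).
    by apply: ereal_inf_lbound; exists u => //; split=> //; apply/eqP.
  apply: ge_ereal_sup => _ [w [Bw /= w0] <-]; rewrite lee_fin.
  have nw0 : 0 < `|w| by rewrite normr_gt0; apply/eqP.
  by rewrite invfM mulrA mulrAC ler_pM2r ?invr_gt0// ler_pdivrMr// bc.
case: x x0 => [x||]//; rewrite lte_fin => x0; rewrite lee_fin inver gt_eqF//= => xc.
by rewrite mulrC ler_pdivlMr// mulrC -ler_pdivlMr.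
Qed.

End InfSup.

Lemma form_norm_bound {R : realType} {V : normedModType R} {a : V -> V -> R} :
  bilinear_form a -> 0 < form_norm a ->
  forall u v, `|a u v| <= form_norm a * `|u| * `|v|.
Proof.
move=> ab; rewrite /form_norm; set S := [set _ | _ in _] => M0.
(* [sup] defaults to 0 on a set without supremum, so a positive value certifies that the quotients
   are bounded. *)
have Ssup : has_sup S by apply: contrapT => /sup_out S0; rewrite S0 ltxx in M0.
have bnd u v : a u v <= sup S * `|u| * `|v|.
  have [->|u0] := eqVneq u 0; first by rewrite (bform0l ab) normr0 mulr0 mul0r.
  have [->|v0] := eqVneq v 0; first by rewrite (bform0r ab) normr0 mulr0.
  have nu0 : 0 < `|u| by rewrite normr_gt0.
  have nv0 : 0 < `|v| by rewrite normr_gt0.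
  rewrite -mulrA -ler_pdivrMr ?mulr_gt0//; apply: ub_le_sup; first by case: Ssup.
  by exists (u, v) => //=; split; apply/eqP.
move=> u v; rewrite ler_norml bnd andbT lerNl -(bformNl ab).
by have := bnd (- u) v; rewrite normrN.
Qed.

Lemma inner_le_norm {R : realType} {W : normedModType R} {ip : W -> W -> R}
    (ipb : bilinear_form ip) (ipC : forall x y, ip x y = ip y x)
    (normW : forall x, `|x| ^+ 2 = ip x x) x y :
  ip x y <= `|x| * `|y|.
Proof.
apply: (le_trans (ler_norm _)).
rewrite -(@ler_pXn2r _ 2)// ?nnegrE ?mulr_ge0// real_normK ?num_real// exprMn !normW.
apply: (form_cauchy_schwarz ipb ipC setT) => // z _.
by rewrite -normW exprn_ge0.
Qed.

(** * The discrete setting and a bounded lifting through [D] *)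

Section Penalty.
Set Implicit Arguments.
Unset Strict Implicit.
Context {R : realType} {V Q : normedModType R}.
Variables (ipV : V -> V -> R) (ipQ : Q -> Q -> R) (D : {linear V -> Q}).
Hypothesis ipV_bilin : bilinear_form ipV.
Hypothesis ipQ_bilin : bilinear_form ipQ.
Hypothesis ipVC : forall x y, ipV x y = ipV y x.
Hypothesis ipQC : forall x y, ipQ x y = ipQ y x.
Hypothesis normV : forall v, `|v| ^+ 2 = ipV v v.
Hypothesis normQ : forall q, `|q| ^+ 2 = ipQ q q.
Variables (VX : set V) (QX : set Q).
Hypothesis VX_fin : fin_dim_subspace VX.
Hypothesis QX_fin : fin_dim_subspace QX.
Hypothesis D_VX : D @` VX = QX.
Let ZX := discrete_ker ipQ D VX QX.
Variable bi : R.
Hypothesis bi_ge0 : 0 <= bi.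
Hypothesis bi_bound : inf_sup_bound (fun q v => ipQ (D v) q) QX VX bi.

Let ipQ_eq0 q : ipQ q q = 0 -> q = 0.
Proof. by rewrite -normQ => /eqP; rewrite expf_eq0/= normr_eq0 => /eqP. Qed.

Let QX_D v : VX v -> QX (D v).
Proof. by rewrite -D_VX => VXv; exists v. Qed.

Let ZX_D z : ZX z -> D z = 0.
Proof.
by move=> [VXz /(_ _ (QX_D VXz))/ipQ_eq0].
Qed.

Let ipQ_le := inner_le_norm ipQ_bilin ipQC normQ.
Let ipV_le := inner_le_norm ipV_bilin ipVC normV.

(* The lifting [w] of minimal norm solves, with a multiplier [q], the saddle
   point problem (w, v)_V = (D v, q)_Q, (D w, r)_Q = (g, r)_Q. *)
Lemma bounded_lift g : QX g ->
  exists w, [/\ VX w, D w = g & `|w| <= bi * `|g|].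
Proof.
move=> QXg.
pose b (x y : V * Q) := ipV x.1 y.1 - ipQ (D y.1) x.2 + ipQ (D x.1) y.2.
have b_bilin : bilinear_form b.
  by split=> [[w r] c [x p] [y q]|[u t] c [x p] [y q]] /=; rewrite /b /=;
    rewrite !linearP ?ipV_bilin.1 ?ipV_bilin.2 ?ipQ_bilin.1 ?ipQ_bilin.2; ring.
have [||[w q] [VXw QXq] wq] :=
    fin_dim_solve (F := fun x => ipQ g x.2) (fin_dimX VX_fin QX_fin) b_bilin.
- by move=> c [x p] [y q] /=; rewrite ipQ_bilin.2.
(* Nondegeneracy: taking [(0, D v)], then [(v, 0)], then [(x, 0)] with [D x = r] as first argument
   of [b] gives [D v = 0], [v = 0] and [r = 0] in turn. *)
- move=> [v r] /= [VXv QXr] vr0.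
  have Dv0 : D v = 0.
    have := vr0 (0, D v); rewrite /b /= linear0 (bform0l ipV_bilin).
    rewrite (bform0l ipQ_bilin) addr0 sub0r => /(_ (conj (fin_dim0 VX_fin) (QX_D VXv))).
    by move=> /eqP; rewrite oppr_eq0 => /eqP/ipQ_eq0.
  have v0 : v = 0.
    have := vr0 (v, 0); rewrite /b /= Dv0 (bform0l ipQ_bilin) (bform0l ipQ_bilin) subr0 addr0.
    rewrite -normV => /(_ (conj VXv (fin_dim0 QX_fin))).
    by move=> /eqP; rewrite expf_eq0/= normr_eq0 => /eqP.
  move: (QXr); rewrite -{1}D_VX => -[x VXx Dx].
  have := vr0 (x, 0); rewrite /b /= v0 linear0 (bform0r ipV_bilin) (bform0l ipQ_bilin) subr0 add0r Dx.
  by move=> /(_ (conj VXx (fin_dim0 QX_fin)))/ipQ_eq0 ->.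
have wE v : VX v -> ipV w v = ipQ (D v) q.
  move=> VXv; have := wq (v, 0) (conj VXv (fin_dim0 QX_fin)).
  by rewrite /b /= !(bform0r ipQ_bilin) addr0 => /eqP; rewrite subr_eq0 => /eqP.
have Dw : D w = g.
  have QXd : QX (D w - g) by apply: (fin_dimB QX_fin) => //; apply: QX_D.
  have := wq (0, D w - g) (conj (fin_dim0 VX_fin) QXd).
  rewrite /b /= linear0 (bform0r ipV_bilin) (bform0l ipQ_bilin) subr0 add0r.
  move=> /eqP; rewrite -subr_eq0 -(bformBl ipQ_bilin).
  by move=> /eqP/ipQ_eq0/subr0_eq.
exists w; split=> //.
(* The inf-sup condition bounds the multiplier [q] by [w]; then [|w|^2 = (g, q)] gives the bound on
   [w]. *)
have qw : `|q| <= bi * `|w|.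
  by apply: bi_bound => // v VXv; rewrite -wE//; exact: ipV_le.
have ww : `|w| ^+ 2 <= bi * `|g| * `|w|.
  rewrite normV wE// Dw (le_trans (ipQ_le _ _))// mulrAC mulrC.
  by rewrite ler_wpM2r// mulrC.
have [->|w0] := eqVneq w 0; first by rewrite normr0 mulr_ge0.
by rewrite -(ler_pM2r (_ : 0 < `|w|)) ?normr_gt0// -expr2.
Qed.

(** * A priori bounds on velocity and multiplier *)

Section Form.
Variables (a : V -> V -> R) (Ma ai : R).
Hypothesis a_bilin : bilinear_form a.
Hypothesis Ma_ge0 : 0 <= Ma.
Hypothesis a_le : forall u v, `|a u v| <= Ma * `|u| * `|v|.
Hypothesis ai_ge0 : 0 <= ai.
Hypothesis ai_bound : inf_sup_bound a ZX ZX ai.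

(** Split [u] as [(u - w) + w] with [w] the bounded lift of [D u]. The difference lies in [ZX],
    where the inf-sup condition bounds it by [Ma |w|], as [a u] vanishes on [ZX]. *)
Lemma stability u : VX u -> (forall z, ZX z -> a u z = 0) ->
  `|u| <= (1 + Ma * ai) * bi * `|D u|.
Proof.
move=> VXu u0; have [w [VXw Dw nw]] := bounded_lift (QX_D VXu).
have Zuw : ZX (u - w).
  split=> [|q _]; first exact: (fin_dimB VX_fin).
  by rewrite linearB Dw subrr (bform0l ipQ_bilin).
have nuw : `|u - w| <= ai * (Ma * `|w|).
  apply: ai_bound => // [|z Zz]; first exact: mulr_ge0.
  rewrite (bformBl a_bilin) u0// sub0r.
  by rewrite (le_trans _ (a_le w z))// -normrN ler_norm.
have : `|u| <= `|u - w| + `|w| by rewrite -{1}(subrK w u) ler_normD.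
have -> : (1 + Ma * ai) * bi * `|D u| = (1 + Ma * ai) * (bi * `|D u|) by ring.
have M0 : 0 <= Ma * ai by apply: mulr_ge0.
have := ler_wpM2l (addr_ge0 ler01 M0) nw.
lra.
Qed.

Lemma multiplier_bound u p c : QX p -> 0 <= c ->
  (forall v, VX v -> a u v + ipQ (D v) p = 0) ->
  (forall v, VX v -> `|a u v| <= c * `|v|) -> `|p| <= bi * c.
Proof.
move=> QXp c0 up ac; apply: bi_bound => // v VXv.
have /eqP := up _ VXv; rewrite addrC addr_eq0 => /eqP ->.
by rewrite (le_trans _ (ac v VXv))// -normrN ler_norm.
Qed.

End Form.

(** * Contraction of the multiplier error *)

Variable rho : R.
Hypothesis rho_gt0 : 0 < rho.

(* Relates the errors [p] and [q] of two successive multipliers to the error [u]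
   of the new velocity; it takes this form, without a penalty term, because
   [lambda = rho]. *)
Definition error_step (a : V -> V -> R) u p q :=
  (forall v, VX v -> a u v + ipQ (D v) p = 0) /\ p = q + rho *: D u.

Definition contracts (a : V -> V -> R) (r : R) := forall u p q,
  VX u -> QX p -> QX q -> error_step a u p q -> `|p| <= r * `|q|.

(** The bound [rho |p| <= K (|p| + |q|)] would give the rate [K / (rho - K)]; the claimed
    denominator is smaller because [1 + Ma ai >= 1]. *)
Lemma contracts_inf_sup a Ma ai K :
  bilinear_form a -> 0 <= Ma -> (forall u v, `|a u v| <= Ma * `|u| * `|v|) ->
  0 <= ai -> inf_sup_bound a ZX ZX ai ->
  K = Ma * (1 + Ma * ai) * bi ^+ 2 -> (1 + Ma * ai) * K < rho ->
  contracts a (K / (rho - (1 + Ma * ai) * K)).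
Proof.
move=> ab M0 aM ai0 aib KE; set Y := 1 + Ma * ai => rhoK u p q VXu QXp QXq [up pE].
have Y1 : 1 <= Y by rewrite lerDl mulr_ge0.
have K0 : 0 <= K by rewrite KE mulr_ge0 ?exprn_ge0// mulr_ge0// (le_trans _ Y1).
have pK : `|p| <= K * `|D u|.
  have nu : `|u| <= Y * bi * `|D u|.
    apply: (stability ab M0 aM ai0 aib VXu) => z Zz; have VXz : VX z by case: Zz.
    by have := up _ VXz; rewrite (ZX_D Zz) (bform0l ipQ_bilin) addr0.
  have np : `|p| <= bi * (Ma * `|u|).
    by apply: (@multiplier_bound a u) => //; apply: mulr_ge0.
  apply: (le_trans np); rewrite KE -/Y.
  have := ler_wpM2l (mulr_ge0 bi_ge0 M0) nu.
  by rewrite !mulrA; congr (_ <= _); ring.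
have nD : rho * `|D u| <= `|p| + `|q|.
  rewrite -[rho]gtr0_norm// -normrZ.
  have -> : rho *: D u = p - q by rewrite pE addrC addKr.
  exact: ler_normB.
have KY : K <= Y * K by rewrite ler_peMl.
rewrite mulrAC ler_pdivlMr ?subr_gt0//.
have h1 := ler_wpM2l (ltW rho_gt0) pK.
have h2 := ler_wpM2l K0 nD.
have h3 := ler_wpM2r (normr_ge0 p) KY.
nra.
Qed.

(** The factor is [1 / (1 + rho / nu)], written so that [nu = 0] is allowed. *)
Lemma contracts_energy a nu : 0 <= nu ->
  (forall u p, VX u -> QX p -> (forall v, VX v -> a u v + ipQ (D v) p = 0) ->
    `|p| ^+ 2 <= nu * a u u) ->
  contracts a (nu / (nu + rho)).
Proof.
move=> nu0 en u p q VXu QXp QXq [up pE].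
have nr0 : 0 < nu + rho by apply: ltr_wpDl.
have [->|p0] := eqVneq p 0; first by rewrite normr0 mulr_ge0// divr_ge0// ltW.
have np0 : 0 < `|p| by rewrite normr_gt0.
have qp : ipQ q p = `|p| ^+ 2 + rho * a u u.
  have -> : q = p - rho *: D u by rewrite pE addrK.
  rewrite (bformBl ipQ_bilin) (bformZl ipQ_bilin) -normQ.
  by have /eqP := up _ VXu; rewrite addr_eq0 => /eqP ->; ring.
(* The chain is [(nu + rho) |p|^2 <= nu |p|^2 + nu rho a(u, u) = nu (q, p) <= nu |q| |p|]. *)
rewrite mulrAC ler_pdivlMr// -(ler_pM2r np0).
have := ler_wpM2l nu0 (ipQ_le q p); rewrite qp.
have := ler_wpM2l (ltW rho_gt0) (en _ _ VXu QXp up).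
rewrite expr2; nra.
Qed.

(** A solution [u] of the homogeneous penalty problem is an error step from [q = 0] to
    [p = rho D u]. Contraction forces [D u = 0], and stability then gives [u = 0]. *)
Lemma contracts_nondegenerate a Ma ai r :
  bilinear_form a -> 0 <= Ma -> (forall u v, `|a u v| <= Ma * `|u| * `|v|) ->
  0 <= ai -> inf_sup_bound a ZX ZX ai -> contracts a r ->
  forall u, VX u -> (forall v, VX v -> a u v + rho * ipQ (D u) (D v) = 0) -> u = 0.
Proof.
move=> ab M0 aM ai0 aib ar u VXu u0.
have QXp : QX (rho *: D u).
  by rewrite -[_ *: _]addr0; apply: (fin_dim_lin QX_fin); [exact: QX_D|exact: fin_dim0].
have Du0 : D u = 0.
  have : `|rho *: D u| <= r * `|0 : Q|.
    apply: (ar u _ 0 VXu QXp (fin_dim0 QX_fin)); split; last by rewrite add0r.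
    by move=> v VXv; rewrite (bformZr ipQ_bilin) ipQC u0.
  by rewrite normr0 mulr0 normr_le0 scaler_eq0 gt_eqF//= => /eqP.
have : `|u| <= (1 + Ma * ai) * bi * `|D u|.
  apply: (stability ab M0 aM ai0 aib VXu) => z [VXz _].
  by have := u0 _ VXz; rewrite Du0 (bform0l ipQ_bilin) mulr0 addr0.
by rewrite Du0 normr0 mulr0 normr_le0 => /eqP.
Qed.

(** * Well-posedness of the iteration and geometric convergence *)

Section Convergence.
Variables (a : V -> V -> R) (Ma ai : R).
Hypothesis a_bilin : bilinear_form a.
Hypothesis Ma_ge0 : 0 <= Ma.
Hypothesis a_le : forall u v, `|a u v| <= Ma * `|u| * `|v|.
Hypothesis ai_ge0 : 0 <= ai.
Hypothesis ai_bound : inf_sup_bound a ZX ZX ai.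
Hypothesis ai_boundT : inf_sup_bound (fun v u => a u v) ZX ZX ai.
Variables (F : V -> R) (G : Q -> R) (uX : V) (pX : Q).
Hypothesis sol : saddle_point_sol ipQ a D VX QX F G uX pX.

Lemma riesz_inv_sol : riesz_inv ipQ QX G = D uX.
Proof.
have [VXu QXp _ uG] := sol.
apply: xget_unique; first by split; [exact: QX_D|exact: uG].
move=> p [QXp' pG]; have QXd : QX (p - D uX) by apply: (fin_dimB QX_fin) => //; apply: QX_D.
by apply/subr0_eq/ipQ_eq0; rewrite (bformBl ipQ_bilin) pG// uG// subrr.
Qed.

(** The saddle point equations eliminate [F] and [G], using [G (D v) = (D uX, D v)]; the penalty
    term then merges with the old multiplier error into the new one. *)
Lemma penalty_iterates_error u p :
  penalty_iterates ipQ a D VX QX F G rho rho u p <->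
  p 0%N = 0 /\ forall n, (0 < n)%N -> [/\ VX (u n), QX (p n) &
    error_step a (uX - u n) (pX - p n) (pX - p n.-1)].
Proof.
have [VXu QXp uF uG] := sol.
rewrite /penalty_iterates riesz_inv_sol; split=> -[p0 up]; split=> // n n0.
  have [VXun QXpn upn pn] := up n n0; split=> //; split.
    move=> v VXv; have := upn v VXv; have := uF v VXv.
    rewrite pn (bformBl a_bilin) !(bformBr ipQ_bilin, bformDr ipQ_bilin, bformNr ipQ_bilin, bformZr ipQ_bilin).
    by rewrite -(uG _ (QX_D VXv)) !(ipQC (D v)); lra.
  by rewrite pn opprD addrA -scalerN opprB -(linearB D).
have [VXun QXpn [upn pn]] := up n n0.
have {}pn : p n = p n.-1 + rho *: (D (u n) - D uX).
  rewrite -[p n](subKr pX) pn opprD addrA subKr -scalerN -(linearN D).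
  by rewrite opprB (linearB D).
split=> // v VXv; have := upn v VXv; have := uF v VXv.
rewrite pn (bformBl a_bilin) !(bformBr ipQ_bilin, bformDr ipQ_bilin, bformNr ipQ_bilin, bformZr ipQ_bilin).
by rewrite -(uG _ (QX_D VXv)) !(ipQC (D v)); lra.
Qed.

Variable r : R.
Hypothesis r_ge0 : 0 <= r.
Hypothesis r_lt1 : r < 1.
Hypothesis r_eq0 : r = 0 -> pX = 0.
Hypothesis ar : contracts a r.
Hypothesis arT : contracts (fun v u => a u v) r.

(** The implication sits under the existential so that a step can be chosen for every [q].
    Solvability asks for nondegeneracy in the test argument, hence for the contraction of the
    transpose. *)
Lemma error_step_solvable q :
  exists e, QX q -> VX e /\ error_step a e (q + rho *: D e) q.
Proof.
have [QXq|] := pselect (QX q); last by exists 0.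
pose b u v := a u v + rho * ipQ (D u) (D v).
have b_bilin : bilinear_form b.
  by split=> [w c x y|w c x y]; rewrite /b linearP ?a_bilin.1 ?a_bilin.2
    ?ipQ_bilin.1 ?ipQ_bilin.2; ring.
have [||e VXe eq] := fin_dim_solve (F := fun v => - ipQ (D v) q) VX_fin b_bilin.
- by move=> c x y; rewrite linearP ipQ_bilin.1; ring.
- move=> w VXw w0.
  apply: (contracts_nondegenerate (bilinear_form_flip a_bilin) Ma_ge0 _ ai_ge0 ai_boundT arT) => //.
    by move=> u v; rewrite (le_trans (a_le _ _))// mulrAC.
  by move=> v VXv; rewrite ipQC; exact: w0.
exists e => _; split=> //; split=> // v VXv.
have := eq v VXv; rewrite /b (bformDr ipQ_bilin) (bformZr ipQ_bilin) (ipQC (D e)); lra.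
Qed.

Lemma contraction_converges :
  converges_geometrically (penalty_iterates ipQ a D VX QX F G rho rho) uX pX r.
Proof.
have [VXu QXp _ _] := sol.
have QX_step q e : QX q -> VX e -> QX (q + rho *: D e).
  by move=> QXq VXe; rewrite addrC; apply: (fin_dim_lin QX_fin) => //; exact: QX_D.
split=> //.
- have [E EP] := choice error_step_solvable.
  (* The multiplier errors, started at [pX] because [p 0 = 0]; the iterates are the solution minus
     the errors. *)
  pose e n := iter n (fun q => q + rho *: D (E q)) pX.
  have QXe n : QX (e n).
    by elim: n => //= n IH; apply: QX_step => //; have [] := EP _ IH.
  exists (fun n => uX - E (e n.-1)), (fun n => pX - e n).
  apply/penalty_iterates_error; split; first by rewrite subrr.
  case=> // n _; rewrite /= !subKr; have [VXE stepE] := EP _ (QXe n).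
  split=> //; first exact: (fin_dimB VX_fin).
  by apply: (fin_dimB QX_fin) => //; exact: QXe n.+1.
- move=> u p u' p' /penalty_iterates_error[p0 up] /penalty_iterates_error[p0' up'].
  have step n : p n = p' n -> u n.+1 = u' n.+1 /\ p n.+1 = p' n.+1.
    move=> pn; have [VXn QXn [un pn1]] := up n.+1 isT.
    have [VXn' QXn' [un' pn1']] := up' n.+1 isT.
    (* Equal previous multipliers cancel, so the difference of the velocities solves the homogeneous
       penalty problem. *)
    have uu : u n.+1 = u' n.+1.
      apply/eqP; rewrite -subr_eq0; apply/eqP.
      apply: (contracts_nondegenerate a_bilin Ma_ge0 a_le ai_ge0 ai_bound ar).
        exact: (fin_dimB VX_fin).
      move=> v VXv; have := un v VXv; have := un' v VXv.
      rewrite pn1 pn1' /= pn !linearB /= !(bformBl a_bilin, bformBl ipQ_bilin).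
      rewrite !(bformDr ipQ_bilin, bformNr ipQ_bilin, bformZr ipQ_bilin) !(ipQC (D v)).
      lra.
    split=> //; apply: (addrI (- pX)); apply: oppr_inj; rewrite !opprD !opprK.
    by rewrite pn1 pn1' /= pn uu.
  have pp n : p n = p' n by elim: n => [|n /step[]//]; rewrite p0 p0'.
  by case=> // n _; exact: step.
- move=> u p /penalty_iterates_error[p0 up].
  have ep n : `|pX - p n| <= r ^+ n * `|pX|.
    elim: n => [|n IH]; first by rewrite p0 subr0 mul1r.
    have [VXn QXn stepn] := up n.+1 isT.
    have QXn' : QX (pX - p n).
      apply: (fin_dimB QX_fin) => //; case: n {IH VXn QXn stepn} => [|n].
        by rewrite p0; exact: fin_dim0.
      by have [] := up n.+1 isT.
    rewrite exprS -mulrA (le_trans (ar _ _ QXn' stepn)) ?ler_wpM2l//.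
      exact: (fin_dimB VX_fin).
    exact: (fin_dimB QX_fin).
  pose U := (1 + Ma * ai) * bi.
  have U0 : 0 <= U by rewrite mulr_ge0// addr_ge0// mulr_ge0.
  (* The velocity error is at most [U / rho] times the sum of the new and the old multiplier error;
     the old one, of order [r ^+ n], costs the factor [r^-1]. The final 1 accounts for the
     multiplier error itself. *)
  exists ((U / rho * (1 + r^-1) + 1) * `|pX|).
    by rewrite mulr_ge0// addr_ge0// mulr_ge0 ?divr_ge0 ?addr_ge0 ?invr_ge0// ltW.
  case=> // n _; have [VXn QXn [upn pn]] := up n.+1 isT.
  have un : `|uX - u n.+1| <= U * `|D (uX - u n.+1)|.
    apply: (stability a_bilin Ma_ge0 a_le ai_ge0 ai_bound).
      exact: (fin_dimB VX_fin).
    move=> z Zz; have VXz : VX z by case: Zz.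
    by have := upn _ VXz; rewrite (ZX_D Zz) (bform0l ipQ_bilin) addr0.
  have Dn : rho * `|D (uX - u n.+1)| <= `|pX - p n.+1| + `|pX - p n|.
    rewrite -[rho]gtr0_norm// -normrZ.
    have -> : rho *: D (uX - u n.+1) = (pX - p n.+1) - (pX - p n).
      by rewrite -[LHS](addKr (pX - p n)) addrC pn.
    exact: ler_normB.
  have rn : r ^+ n * `|pX| = r^-1 * (r ^+ n.+1 * `|pX|).
    (* For [r = 0] no power of [r] can be recovered, and the identity holds only because
       [pX = 0]. *)
    have [/r_eq0 ->|r0] := eqVneq r 0; first by rewrite normr0 !mulr0.
    by rewrite exprS !mulrA mulVf// mul1r.
  have := ep n.+1; have := ep n; rewrite rn => en en1.
  have Dn' : `|D (uX - u n.+1)| <= (1 + r^-1) / rho * (r ^+ n.+1 * `|pX|).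
    rewrite mulrAC ler_pdivlMr// mulrC mulrDl mul1r (le_trans Dn)// lerD//.
  have := le_trans un (ler_wpM2l U0 Dn').
  rewrite -/(U / rho); nra.
Qed.

End Convergence.
End Penalty.

(** * Extended-real formulas for the constants and the rates *)

Lemma fine_inve_ge0 {R : realType} {x : \bar R} : (0 < x)%E -> 0 <= fine x^-1.
Proof. by move=> x0; rewrite fine_ge0// inve_ge0 ltW. Qed.

Section Rates.
Context {R : realType} (Ma : R) (alphaX betaX : \bar R).
Hypothesis Ma_gt0 : 0 < Ma.
Hypothesis alphaX_gt0 : (0 < alphaX)%E.
Hypothesis betaX_gt0 : (0 < betaX)%E.
Let ai := fine alphaX^-1.
Let bi := fine betaX^-1.
Let Y := 1 + Ma * ai.
Let K := Ma * Y * bi ^+ 2.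

Let Y_gt0 : 0 < Y.
Proof. by rewrite ltr_wpDr// mulr_ge0 ?fine_inve_ge0// ltW. Qed.

Lemma UpsilonE : Upsilon Ma alphaX = Y%:E.
Proof.
rewrite /Upsilon /Y /ai; case: alphaX alphaX_gt0 => [x||]//=.
  by rewrite lte_fin => x0; rewrite inver gt_eqF.
Qed.

Lemma eps0E (b : R) : betaX = b%:E ->
  eps0 Ma alphaX betaX = (b ^+ 2 / (Ma * Y ^+ 2))%:E.
Proof.
rewrite /eps0 UpsilonE => ->; rewrite !inver !gt_eqF//=.
rewrite -!EFinM; congr EFin; field.
by rewrite !gt_eqF.
Qed.

Lemma eps0y : betaX = +oo%E -> eps0 Ma alphaX betaX = +oo%E.
Proof.
rewrite /eps0 UpsilonE => ->; rewrite !inver !gt_eqF//=.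
by rewrite gt0_mulye ?lte_fin ?invr_gt0// mulyy gt0_muley ?lte_fin ?invr_gt0.
Qed.

(** For finite [betaX], [1 / eps0 = Y K], and multiplying by [1 + 1 / Y] gives [(1 + Y) K]. For
    [betaX = +oo] both sides are 0. *)
Lemma rho0E : rho0 Ma alphaX betaX = ((1 + Y) * K)%:E.
Proof.
rewrite /rho0 UpsilonE /K /bi; case: betaX betaX_gt0 eps0E eps0y => [b||]// b0 eE ey.
  rewrite (eE b)//; rewrite lte_fin in b0.
  rewrite !inver !gt_eqF ?divr_gt0 ?mulr_gt0 ?exprn_gt0//= -EFinD -EFinM.
  congr EFin; field.
  by rewrite !gt_eqF.
by rewrite ey// invey mul0e /= expr0n !mulr0.
Qed.

(** For infinite [alphaX] the right-hand side is +oo divided by +oo, which evaluates to 0 and not to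
    the threshold [2 Ma bi^2] when [betaX] is finite. *)
Lemma rho0_quotient : (alphaX < +oo)%E ->
  rho0 Ma alphaX betaX = ((Ma%:E + alphaX) * (Ma%:E + 2%:E * alphaX) * Ma%:E
                          / (alphaX ^+ 2 * betaX ^+ 2))%E.
Proof.
rewrite rho0E /K /bi /Y /ai.
case: alphaX alphaX_gt0 => [x||]// + _; rewrite lte_fin => x0.
rewrite inver gt_eqF//=.
case: betaX betaX_gt0 => [b||]// b0; last first.
  by rewrite invey /= expr0n !mulr0 ?expe2 mulyy -EFinM gt0_muley ?lte_fin ?mulr_gt0// invey mule0.
rewrite lte_fin in b0.
rewrite inver gt_eqF//= -?EFin_expe -!EFinM.
rewrite inver gt_eqF ?mulr_gt0//.
rewrite -EFinM; congr EFin; field.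
by rewrite !gt_eqF.
Qed.

Section General.
Variable rho : R.
Hypothesis rhoK : (1 + Y) * K < rho.
Let K_ge0 : 0 <= K.
Proof. by rewrite mulr_ge0// ?exprn_ge0 ?fine_inve_ge0// mulr_ge0// ltW. Qed.
Let rho_gt0 : 0 < rho.
Proof. by rewrite (le_lt_trans _ rhoK)// mulr_ge0// addr_ge0// ltW. Qed.
Let den_gt0 : 0 < rho - Y * K.
Proof. by rewrite subr_gt0 (le_lt_trans _ rhoK)// ler_wpM2r// lerDr. Qed.

Lemma rate_eps0 :
  (K / (rho - Y * K))%:E
  = ((Upsilon Ma alphaX * (rho%:E * eps0 Ma alphaX betaX - 1))^-1)%E.
Proof.
move: den_gt0; rewrite UpsilonE /K /bi.
case: betaX betaX_gt0 eps0E eps0y => [b||]// b0 eE ey den; last first.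
  by rewrite ey//= expr0n !mulr0 mul0r gt0_muley ?lte_fin// addye// gt0_muley ?lte_fin// invey.
rewrite (eE b)//; rewrite lte_fin in b0.
rewrite inver gt_eqF//= in den *.
have e1 : Y * (rho * (b ^+ 2 / (Ma * Y ^+ 2)) - 1)
    = (rho - Y * (Ma * Y * b^-1 ^+ 2)) / (Ma * Y * b^-1 ^+ 2).
  by field; rewrite !gt_eqF.
have K0 : 0 < Ma * Y * b^-1 ^+ 2 by rewrite !mulr_gt0 ?exprn_gt0 ?invr_gt0.
rewrite -!EFinM e1 inver gt_eqF ?divr_gt0//.
by rewrite invf_div.
Qed.

(** Numerator and denominator share the factor [1 + Y], since [rho0 = (1 + Y) K]. *)
Lemma rate_rho0 :
  (K / (rho - Y * K))%:E
  = (rho0 Ma alphaX betaX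
     / (Upsilon Ma alphaX * (rho%:E - rho0 Ma alphaX betaX) + rho%:E))%E.
Proof.
rewrite UpsilonE rho0E -EFinB -EFinM -EFinD.
have Y1 : 0 < 1 + Y by rewrite ltr_wpDl// ltW.
have -> : Y * (rho - (1 + Y) * K) + rho = (1 + Y) * (rho - Y * K) by ring.
rewrite inver gt_eqF ?mulr_gt0// -EFinM; congr EFin; field.
by rewrite !gt_eqF.
Qed.

Lemma rate_quotient : (alphaX < +oo)%E ->
  (K / (rho - Y * K))%:E
  = (Ma%:E * alphaX * (alphaX + Ma%:E)
     / (rho%:E * alphaX ^+ 2 * betaX ^+ 2 - Ma%:E * (alphaX + Ma%:E) ^+ 2))%E.
Proof.
move: den_gt0; rewrite /K /bi /Y /ai.
case: alphaX alphaX_gt0 => [x||]// + + _; rewrite lte_fin => x0.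
rewrite inver gt_eqF//=.
case: betaX betaX_gt0 => [b||]// b0 den; last first.
  rewrite /= expr0n !mulr0 mul0r ?expe2 mulyy -!EFinM gt0_muley ?lte_fin ?mulr_gt0//.
  by rewrite addye// invey mule0.
rewrite lte_fin in b0.
rewrite inver gt_eqF//= in den *.
rewrite -!EFinM -EFinD.
have e : rho * (x * x) * (b * b) - Ma * ((x + Ma) * (x + Ma))
    = x ^+ 2 * b ^+ 2
      * (rho - (1 + Ma * x^-1) * (Ma * (1 + Ma * x^-1) * b^-1 ^+ 2)).
  by field; rewrite !gt_eqF.
rewrite e inver gt_eqF ?mulr_gt0 ?exprn_gt0// -EFinM; congr EFin.
set d := rho - _ in den *.
field.
by rewrite !gt_eqF.
Qed.

End General.

Lemma rate_energy (c rho : R) : 0 < c -> 0 < rho ->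
  (c * bi ^+ 2 / (c * bi ^+ 2 + rho))%:E = (c%:E / (c%:E + rho%:E * betaX ^+ 2))%E.
Proof.
move=> c0 rho0; rewrite /bi; case: betaX betaX_gt0 => [b||]// b0; last first.
  by rewrite /= expr0n !mulr0 mul0r ?expe2 mulyy gt0_muley ?lte_fin// addey// invey mule0.
rewrite lte_fin in b0.
rewrite inver gt_eqF//= -?EFin_expe -EFinM -EFinD inver gt_eqF; last first.
  by rewrite addr_gt0// !mulr_gt0.
rewrite -EFinM; congr EFin; field.
by rewrite !gt_eqF ?addr_gt0 ?mulr_gt0 ?exprn_gt0.
Qed.

End Rates.

(** * Assembly: inf-sup contraction in general, energy contraction in the coercive cases *)

Theorem corollary4p4 (R : realType)
  (* Hilbert spaces *)
  (V Q : completeNormedModType R)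
  (ipV : {dot V for @idfun R}) (ipQ : {dot Q for @idfun R})
  (normV : forall v : V, `|v| ^+ 2 = ipV v v)
  (normQ : forall q : Q, `|q| ^+ 2 = ipQ q q)
  (* continuous problem *)
  (a : {biscalar V}) (a_cont : continuous (fun uv : V * V => a uv.1 uv.2))
  (D : {linear V -> Q})
  (D_bounded : exists C : R, forall v, `|D v| <= C * `|v|)
  (D_surj : forall q : Q, exists v : V, D v = q)
  (alpha : R) (alpha_gt0 : 0 < alpha)
  (infsup_Z : (alpha%:E <= infsup a (ker_op D) (ker_op D))%E)
  (infsup_Zt : (alpha%:E <= infsup (fun v u => a u v) (ker_op D) (ker_op D))%E)
  (* discrete spaces *)
  (VX : set V) (QX : set Q)
  (VX_fin : fin_dim_subspace VX) (QX_fin : fin_dim_subspace QX)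
  (D_VX : D @` VX = QX)
  (Ma : R) (Ma_def : Ma = form_norm a) (Ma_gt0 : 0 < Ma)
  (ZX : set V) (ZX_def : ZX = discrete_ker ipQ D VX QX)
  (alphaX betaX : \bar R)
  (alphaX_def : alphaX = infsup a ZX ZX)
  (alphaX_def' : alphaX = infsup (fun v u => a u v) ZX ZX)
  (alphaX_gt0 : (0 < alphaX)%E)
  (betaX_def : betaX = infsup (fun q v => ipQ (D v) q) QX VX)
  (betaX_gt0 : (0 < betaX)%E)
  (* data, discrete solution and penalty parameter *)
  (F : V -> R) (F_dual : in_dual VX F) (G : Q -> R) (G_dual : in_dual QX G)
  (uX : V) (pX : Q) (sol : saddle_point_sol ipQ a D VX QX F G uX pX)
  (rho : R) :
  let converges_with_rate := converges_geometrically
        (penalty_iterates ipQ a D VX QX F G rho rho) uX pX in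
  let a_sym := forall u v : V, a u v = a v u in
  [/\ (* (i) *)
      ((alphaX < +oo)%E ->
        rho0 Ma alphaX betaX
        = ((Ma%:E + alphaX) * (Ma%:E + 2%:E * alphaX) * Ma%:E
           / (alphaX ^+ 2 * betaX ^+ 2))%E) /\
      ((rho0 Ma alphaX betaX < rho%:E)%E ->
       exists2 r : R,
         [/\ r%:E = ((Upsilon Ma alphaX
                       * (rho%:E * eps0 Ma alphaX betaX - 1))^-1)%E,
             r%:E = (rho0 Ma alphaX betaX
                      / (Upsilon Ma alphaX * (rho%:E - rho0 Ma alphaX betaX)
                         + rho%:E))%E
           & (alphaX < +oo)%E ->
             r%:E = (Ma%:E * alphaX * (alphaX + Ma%:E)
                      / (rho%:E * alphaX ^+ 2 * betaX ^+ 2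
                         - Ma%:E * (alphaX + Ma%:E) ^+ 2))%E]
         & converges_with_rate r),
      (* (ii), symmetric, nonnegative, coercive on the kernel *)
      (forall alphat : R, 0 < alphat -> a_sym ->
         (forall u, VX u -> 0 <= a u u) ->
         (forall z, ZX z -> alphat * `|z| ^+ 2 <= a z z) ->
         0 < rho ->
         exists2 r : R,
           r%:E = (Ma%:E / (Ma%:E + rho%:E * betaX ^+ 2))%E
           & converges_with_rate r)
    & (* (ii), coercive *)
      (forall alphat : R, 0 < alphat ->
         (forall u, VX u -> alphat * `|u| ^+ 2 <= a u u) ->
         0 < rho ->
         exists2 r : R,
           r%:E = ((Ma * Upsilon_coercive a Ma alphat)%:E
                    / ((Ma * Upsilon_coercive a Ma alphat)%:E
                       + rho%:E * betaX ^+ 2))%E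
           & converges_with_rate r)].
Proof.
move=> converges_with_rate a_sym.
have ab : bilinear_form a.
  by split=> [w|u] c x y; [exact: linearPl|exact: linearPr].
have ipVb : bilinear_form ipV.
  by split=> [w|u] c x y; [exact: linearPl|exact: linearPr].
have ipQb : bilinear_form ipQ.
  by split=> [w|u] c x y; [exact: linearPl|exact: linearPr].
have ipVC x y : ipV x y = ipV y x by rewrite hermC expr0 mul1r.
have ipQC x y : ipQ x y = ipQ y x by rewrite hermC expr0 mul1r.
have Ma0 := ltW Ma_gt0.
have aM u v : `|a u v| <= Ma * `|u| * `|v|.
  by rewrite Ma_def form_norm_bound// -Ma_def.
have aMT u v : `|a v u| <= Ma * `|u| * `|v| by rewrite mulrAC.
pose ai := fine alphaX^-1; pose bi := fine betaX^-1.
have ai0 : 0 <= ai := fine_inve_ge0 alphaX_gt0.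
have bi0 : 0 <= bi := fine_inve_ge0 betaX_gt0.
have aiB : inf_sup_bound a ZX ZX ai.
  by rewrite /ai alphaX_def; apply: infsup_bound; rewrite -alphaX_def.
have aiBT : inf_sup_bound (fun v u => a u v) ZX ZX ai.
  by rewrite /ai alphaX_def'; apply: infsup_bound; rewrite -alphaX_def'.
have biB : inf_sup_bound (fun q v => ipQ (D v) q) QX VX bi.
  by rewrite /bi betaX_def; apply: infsup_bound; rewrite -betaX_def.
have ZXD z : ZX z -> VX z by rewrite ZX_def => -[].
subst ZX.
(* [bi = 0] means [betaX = +oo], which leaves no nonzero multiplier; this settles the case of rate
   0. *)
have pX_eq0 : bi = 0 -> pX = 0.
  move=> bi00; have [_ QXp _ _] := sol; have [C DC] := D_bounded.
  apply/eqP; rewrite -normr_le0.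
  have := biB _ QXp (`|C| * `|pX|); rewrite bi00 mul0r; apply.
    by rewrite mulr_ge0.
  move=> v _; apply: (le_trans (inner_le_norm ipQb ipQC normQ _ _)).
  rewrite mulrAC ler_wpM2r// (le_trans (DC v))//.
  by rewrite ler_wpM2r// ler_norm.
have conv r : 0 <= r -> r < 1 -> (r = 0 -> bi = 0) -> 0 < rho ->
    contracts ipQ D VX QX rho a r ->
    contracts ipQ D VX QX rho (fun v u => a u v) r -> converges_with_rate r.
  move=> r0 r1 rbi rho0 ar arT.
  exact: (contraction_converges ipVb ipQb ipVC ipQC normV normQ VX_fin QX_fin
    D_VX bi0 biB rho0 ab Ma0 aM ai0 aiB aiBT sol r0 r1 (pX_eq0 \o rbi) ar arT).
have bi_sq c : 0 < c -> c * bi ^+ 2 = 0 -> bi = 0.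
  by move=> c0 /eqP; rewrite mulf_eq0 gt_eqF//= expf_eq0/= => /eqP.
(* The energy contraction with [nu = c bi^2]. Transposition does not change [a u u], so the same
   bound serves [a] and its transpose. *)
have conv_energy c : 0 < c -> 0 < rho -> (forall u p, VX u -> QX p ->
      (forall v, VX v -> a u v + ipQ (D v) p = 0) ->
      `|p| ^+ 2 <= c * bi ^+ 2 * a u u) ->
    (forall u p, VX u -> QX p -> (forall v, VX v -> a v u + ipQ (D v) p = 0) ->
      `|p| ^+ 2 <= c * bi ^+ 2 * a u u) ->
    exists2 r : R, r%:E = (c%:E / (c%:E + rho%:E * betaX ^+ 2))%E
                 & converges_with_rate r.
  move=> c0 rho_gt0 en enT; exists (c * bi ^+ 2 / (c * bi ^+ 2 + rho)).
    exact: rate_energy.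
  have cb0 : 0 <= c * bi ^+ 2 by rewrite mulr_ge0 ?exprn_ge0// ltW.
  have cbr0 : 0 < c * bi ^+ 2 + rho by apply: ltr_wpDl.
  apply: conv => //.
  - by rewrite divr_ge0// ltW.
  - by rewrite ltr_pdivrMr// mul1r ltrDl.
  - move=> /eqP; rewrite mulf_eq0 invr_eq0 (gt_eqF cbr0) orbF => /eqP.
    exact: bi_sq.
  - exact: contracts_energy.
  - exact: contracts_energy.
(* For symmetric nonnegative [a], Cauchy-Schwarz for [a] gives
   a(u, v)^2 <= a(u, u) M_a |v|^2. *)
have sym_energy (f : V -> V -> R) : bilinear_form f -> (forall u v, f u v = f v u) ->
    (forall u, VX u -> 0 <= f u u) -> (forall u v, `|f u v| <= Ma * `|u| * `|v|) ->
    forall u p, VX u -> QX p -> (forall v, VX v -> f u v + ipQ (D v) p = 0) ->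
      `|p| ^+ 2 <= Ma * bi ^+ 2 * f u u.
  move=> fb fC f0 fM u p VXu QXp up.
  have fuv v : VX v -> `|f u v| <= Num.sqrt (f u u * Ma) * `|v|.
    move=> VXv; rewrite -(@ler_pXn2r _ 2)// ?nnegrE ?mulr_ge0 ?sqrtr_ge0//.
    rewrite real_normK ?num_real// exprMn sqr_sqrtr ?mulr_ge0 ?f0//.
    apply: (le_trans (form_cauchy_schwarz fb fC VX (fin_dim_lin VX_fin) f0 _ _ VXu VXv)).
    rewrite -mulrA ler_wpM2l ?f0// expr2 mulrA.
    by rewrite (le_trans _ (fM v v))// ler_norm.
  have np := multiplier_bound biB QXp (sqrtr_ge0 _) up fuv.
  have -> : Ma * bi ^+ 2 * f u u = (bi * Num.sqrt (f u u * Ma)) ^+ 2.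
    by rewrite exprMn sqr_sqrtr ?mulr_ge0 ?f0//; ring.
  by rewrite ler_pXn2r ?nnegrE ?mulr_ge0 ?sqrtr_ge0.
split.
- split; first by move=> ?; apply: rho0_quotient.
  rewrite rho0E// -/ai -/bi; set Y := 1 + Ma * ai; set K := Ma * Y * bi ^+ 2.
  rewrite lte_fin => rhoK.
  have Y0 : 0 < Y by rewrite ltr_wpDr// mulr_ge0.
  have K0 : 0 <= K by rewrite mulr_ge0 ?exprn_ge0// mulr_ge0// ltW.
  have rho_gt0 : 0 < rho by rewrite (le_lt_trans _ rhoK)// mulr_ge0// addr_ge0// ltW.
  (* The threshold [rho0 = (1 + Y) K] is exactly what makes the rate less than 1. *)
  have KYr : K < rho - Y * K by rewrite ltrBrDr; move: rhoK; rewrite mulrDl mul1r.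
  have YKr : Y * K < rho by rewrite -subr_gt0 (le_lt_trans K0).
  exists (K / (rho - Y * K)).
    split; first exact: rate_eps0.
      by rewrite -rho0E//; exact: rate_rho0.
    by move=> ?; exact: rate_quotient.
  have den : 0 < rho - Y * K by rewrite subr_gt0.
  apply: conv => //.
  + by rewrite divr_ge0// ltW.
  + by rewrite ltr_pdivrMr// mul1r.
  + move=> /eqP; rewrite mulf_eq0 invr_eq0 (gt_eqF den) orbF => /eqP.
    by apply: bi_sq; rewrite mulr_gt0.
  + exact: (contracts_inf_sup ipVb ipQb ipVC ipQC normV normQ VX_fin QX_fin D_VX
      bi0 biB rho_gt0 ab Ma0 aM ai0 aiB erefl).
  + exact: (contracts_inf_sup ipVb ipQb ipVC ipQC normV normQ VX_fin QX_fin D_VX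
      bi0 biB rho_gt0 (bilinear_form_flip ab) Ma0 aMT ai0 aiBT erefl).
- move=> alphat alphat0 aC a0 _ rho_gt0; apply: conv_energy => //.
    exact: sym_energy.
  apply: (sym_energy (fun v u => a u v)) => //.
  exact: bilinear_form_flip.
- move=> alphat alphat0 coer rho_gt0.
  have a0 u : VX u -> 0 <= a u u.
    by move=> /coer; apply: le_trans; rewrite mulr_ge0 ?exprn_ge0// ltW.
  have Ups0 : 0 < Upsilon_coercive a Ma alphat.
    by rewrite /Upsilon_coercive; case: ifP => _; rewrite ?sqrtr_gt0 divr_gt0.
  have coer_energy (f : V -> V -> R) : bilinear_form f ->
      (forall u v, `|f u v| <= Ma * `|u| * `|v|) -> (forall u, f u u = a u u) ->
      (a_sym -> forall u v, f u v = f v u) ->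
      forall u p, VX u -> QX p -> (forall v, VX v -> f u v + ipQ (D v) p = 0) ->
      `|p| ^+ 2 <= Ma * Upsilon_coercive a Ma alphat * bi ^+ 2 * a u u.
    move=> fb fM fE fC u p VXu QXp up.
    rewrite /Upsilon_coercive; case: asboolP => [aC|_].
      have f0 w : VX w -> 0 <= f w w by rewrite fE; exact: a0.
      (* The symmetric bound with constant [Ma] suffices, as [sqrt (Ma / alphat) >= 1]; this follows
         from [alphat |u|^2 <= a(u, u) <= Ma |u|^2] for nonzero [u]. *)
      apply: (le_trans (sym_energy _ fb (fC aC) f0 fM _ _ VXu QXp up)).
      rewrite fE mulrAC [leRHS]mulrAC ler_wpM2r ?exprn_ge0// -!mulrA ler_wpM2l//.
      have [->|u0] := eqVneq u 0; first by rewrite (bform0l ab) mulr0.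
      rewrite ler_peMl ?a0// -sqrtr1 ler_wsqrtr// ler_pdivlMr// mul1r.
      have nu0 : 0 < `|u| ^+ 2 by rewrite exprn_gt0// normr_gt0.
      rewrite -(ler_pM2r nu0) (le_trans (coer _ VXu))// expr2 mulrA.
      by rewrite (le_trans _ (aM u u))// ler_norm.
    (* Without symmetry, continuity of the form bounds [p] by [u], and coercivity trades [|u|^2] for
       [a(u, u) / alphat]. *)
    have np : `|p| <= bi * (Ma * `|u|).
      by apply: (multiplier_bound biB QXp _ up) => // ; rewrite mulr_ge0.
    apply: (@le_trans _ _ ((bi * (Ma * `|u|)) ^+ 2)).
      by rewrite ler_pXn2r ?nnegrE ?mulr_ge0.
    have -> : (bi * (Ma * `|u|)) ^+ 2
        = Ma * (Ma / alphat) * bi ^+ 2 * (alphat * `|u| ^+ 2).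
      by field; rewrite gt_eqF.
    by rewrite ler_wpM2l ?coer// !mulr_ge0 ?exprn_ge0 ?invr_ge0// ltW.
  apply: conv_energy => //; first by rewrite mulr_gt0.
    exact: coer_energy.
  apply: (coer_energy (fun v u => a u v)) => //.
  exact: bilinear_form_flip.
Qed.
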